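(* Let $M$ and $N$ be smooth manifolds and let $\pi\colon C^\infty(M)\to C^\infty(N)$ be a surjective homomorphism of algebras. Then $\pi=F^*$ is the pullback $f\mapsto f\circ F$ of a proper embedding $F\colon N\to M$, and $S:=F(N)$ is a closed embedded submanifold of $M$.
   Context: Smooth manifolds are without boundary. $C^\infty(M)$ denotes the algebra of real-valued smooth functions on $M$, regarded as a real unital associative commutative algebra. A proper embedding is a smooth embedding that is a proper map. *)

(* Defs.v *)
From HB Require Import structures.
From mathcomp Require Import all_boot all_order all_algebra.
From mathcomp Require Import all_classical all_reals all_analysis.

Set Implicit Arguments.
Unset Strict Implicit.
Unset Printing Implicit Defensive.

Import Order.TTheory GRing.Theory Num.Theory.
Import numFieldNormedType.Exports.

Local Open Scope classical_set_scope.
Local Open Scope ring_scope.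

Section smooth_on.
Context {R : realType}.

(* The codomain is [R^o] (that is, [R] as a module over itself), so that
   functions form an R-module. *)
Definition partial n (s : seq 'I_n) (f : 'rV[R]_n -> R^o) : 'rV[R]_n -> R^o :=
  foldr (fun i g => 'D_(delta_mx 0 i) g) f s.

(* Meant for [U] open: ['D_v g x] and continuity at [x] only depend on the
   function near [x], so the junk values outside [U] are irrelevant. *)
Definition smooth_on n (U : set 'rV[R]_n) (f : 'rV[R]_n -> R^o) : Prop :=
  forall (s : seq 'I_n) x, U x ->
    {for x, continuous (partial s f)} /\
    (forall i, derivable (partial s f) x (delta_mx 0 i)).

Definition smooth_map_on n m (U : set 'rV[R]_n) (f : 'rV[R]_n -> 'rV[R]_m) :=
  forall j, smooth_on U (fun x => f x 0 j).

Lemma smooth_on_coind n (U : set 'rV[R]_n) (P : set ('rV[R]_n -> R^o)) f :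
  (forall g, P g -> forall x, U x -> {for x, continuous g} /\
     (forall i, derivable g x (delta_mx 0 i))) ->
  (forall g i, P g -> P ('D_(delta_mx 0 i) g)) ->
  P f -> smooth_on U f.
Proof.
move=> Preg Pd Pf s; suff: P (partial s f) by move/Preg.
by elim: s => //= i s; exact: Pd.
Qed.

Lemma smooth_onD n (U : set 'rV[R]_n) f i :
  smooth_on U f -> smooth_on U ('D_(delta_mx 0 i) f).
Proof.
by move=> sf s; have := sf (rcons s i); rewrite /partial foldr_rcons.
Qed.

Lemma smooth_on_cst n (U : set 'rV[R]_n) (c : R) : smooth_on U (cst c).
Proof.
apply: (@smooth_on_coind _ _ [set g | exists c, g = cst c]); last by exists c.
- move=> _ [{}c ->] x _; split; first exact: cst_continuous.
  by move=> i; exact: derivable_cst.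
- move=> _ i [{}c ->]; exists 0; apply/funext => x.
  exact: derive_cst.
Qed.

(* the functions that agree on [U] with a sum of products of smooth ones *)
Inductive sum_of_prods n (U : set 'rV[R]_n) (h : 'rV[R]_n -> R^o) : Prop :=
| SProd f g of smooth_on U f & smooth_on U g &
    (forall x, U x -> h x = (f * g) x)
| SSum f g of sum_of_prods U f & sum_of_prods U g &
    (forall x, U x -> h x = (f + g) x).

Lemma sum_of_prods_smooth n (U : set 'rV[R]_n) h : open U ->
  sum_of_prods U h -> smooth_on U h.
Proof.
move=> oU.
have nearU (x : 'rV[R]_n) (u v : 'rV[R]_n -> R^o) :
    U x -> (forall y, U y -> u y = v y) ->
    \forall y \near x, v y = u y.
  move=> Ux uv; have := open_nbhs_nbhs (conj oU Ux).
  by apply: filterS => y /uv.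
have reg g : sum_of_prods U g -> forall x, U x -> {for x, continuous g} /\
    (forall i, derivable g x (delta_mx 0 i)).
  elim=> {}g u v.
  - move=> su sv guv x Ux.
    have [cu du] := su [::] x Ux; have [cv dv] := sv [::] x Ux.
    have E := nearU _ _ _ Ux guv; split.
    + rewrite /prop_for /continuous_at (guv _ Ux).
      apply: cvg_trans; first exact: near_eq_cvg E.
      exact: cvgM cu cv.
    + by move=> i; apply: near_eq_derivable E _; exact: derivableM.
  - move=> _ ru _ rv guv x Ux.
    have [cu du] := ru x Ux; have [cv dv] := rv x Ux.
    have E := nearU _ _ _ Ux guv; split.
    + rewrite /prop_for /continuous_at (guv _ Ux).
      apply: cvg_trans; first exact: near_eq_cvg E.
      exact: cvgD cu cv.
    + by move=> i; apply: near_eq_derivable E _; exact: derivableD.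
apply: smooth_on_coind => // g i; elim=> {}g u v.
- move=> su sv guv.
  have suD := smooth_onD i su; have svD := smooth_onD i sv.
  apply: (@SSum _ _ _ (u * 'D_(delta_mx 0 i) v) (v * 'D_(delta_mx 0 i) u)).
  + exact: SProd su svD _.
  + exact: SProd sv suD _.
  move=> x Ux; rewrite -(near_eq_derive _ (nearU _ _ _ Ux guv)) deriveM //.
  + by have [_ ] := su [::] x Ux; apply.
  + by have [_ ] := sv [::] x Ux; apply.
- move=> pu Du pv Dv guv; apply: SSum Du Dv _ => x Ux.
  rewrite -(near_eq_derive _ (nearU _ _ _ Ux guv)) deriveD //.
  + by have [_ ] := reg _ pu x Ux; apply.
  + by have [_ ] := reg _ pv x Ux; apply.
Qed.

Lemma smooth_onM n (U : set 'rV[R]_n) f g : open U ->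
  smooth_on U f -> smooth_on U g -> smooth_on U (f * g).
Proof. by move=> oU sf sg; apply: sum_of_prods_smooth => //; exact: SProd sf sg _. Qed.

Lemma smooth_onB n (U : set 'rV[R]_n) f g : open U ->
  smooth_on U f -> smooth_on U g -> smooth_on U (f - g).
Proof.
move=> oU sf sg; apply: sum_of_prods_smooth => //.
have p k h : smooth_on U h -> sum_of_prods U (cst k * h).
  by move=> sh; apply: (SProd (@smooth_on_cst _ U k) sh).
apply: (SSum (p 1 f sf) (p (-1) g sg)).
by move=> x _; rewrite /= -[RHS]/(1 * f x + -1 * g x) mul1r mulN1r.
Qed.

End smooth_on.

Section manifolds.
Variable R : realType.

(* The total function [cinv] matters only on the open set [cmap @` cdom];
   when [T] is empty there is no chart at all. *)
Record chart (n : nat) (T : topologicalType) := Chart {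
  cdom : set T ;
  cmap : T -> 'rV[R]_n ;
  cinv : 'rV[R]_n -> T ;
  open_cdom : open cdom ;
  open_cimg : open (cmap @` cdom) ;
  cmapK : forall x, cdom x -> cinv (cmap x) = x ;
  cmap_continuous : forall x, cdom x -> {for x, continuous cmap} ;
  cinv_continuous : forall v, (cmap @` cdom) v -> {for v, continuous cinv}
}.

Definition cimg n T (c : chart n T) : set 'rV[R]_n := cmap c @` cdom c.

(* A smooth structure is given by an atlas, not required to be maximal: every
   atlas is contained in exactly one maximal atlas, and all the notions below
   take the same value for the two. *)
Record smooth_structure (n : nat) (T : topologicalType) := SmoothStructure {
  atlas : set (chart n T) ;
  atlas_cover : forall x, exists2 c, atlas c & cdom c x ;
  atlas_compatible : forall c d, atlas c -> atlas d ->
    smooth_map_on (cmap c @` (cdom c `&` cdom d)) (cmap d \o cinv c)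
}.

Record manifold (n : nat) := Manifold {
  carrier :> topologicalType ;
  hausdorff_manifold : hausdorff_space carrier ;
  second_countable_manifold : @second_countable carrier ;
  structure : smooth_structure n carrier
}.

Definition charts n (M : manifold n) : set (chart n M) := atlas (structure M).

Definition smooth_fun n (M : manifold n) (f : M -> R^o) : Prop :=
  forall c, charts c -> smooth_on (cimg c) (f \o cinv c).

Definition smooth_map n m (N : manifold n) (M : manifold m) (F : N -> M) :=
  continuous F /\
  forall c d, charts c -> charts d ->
    smooth_map_on (cmap c @` (cdom c `&` F @^-1` cdom d))
                  (cmap d \o F \o cinv c).

(* injectivity of the differential of [F] at every point, read in charts *)
Definition immersion n m (N : manifold n) (M : manifold m) (F : N -> M) :=
  smooth_map F /\
  forall q (c : chart n N) (d : chart m M),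
    charts c -> charts d -> cdom c q -> cdom d (F q) ->
    injective ('d (cmap d \o F \o cinv c) (cmap c q)).

Definition topological_embedding (T U : topologicalType) (F : T -> U) :=
  [/\ continuous F, injective F &
      forall A, open A -> exists2 B, open B & F @` A = range F `&` B].

Definition smooth_embedding n m (N : manifold n) (M : manifold m)
    (F : N -> M) := immersion F /\ topological_embedding F.

Definition proper_map (T U : topologicalType) (F : T -> U) :=
  continuous F /\ forall K, compact K -> compact (F @^-1` K).

Definition proper_embedding n m (N : manifold n) (M : manifold m)
    (F : N -> M) := smooth_embedding F /\ proper_map F.

(* [S], in the subspace topology carried by the type [set_type S], has a smooth
   structure for which the inclusion is a smooth embedding. *)
Definition embedded_submanifold m (M : manifold m) (S : set M) : Prop :=
  exists (k : nat) (X : smooth_structure k (set_type S))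
    (hX : hausdorff_space (set_type S))
    (cX : @second_countable (set_type S)),
    smooth_embedding (N := Manifold hX cX X) (M := M) set_val.

End manifolds.

Section smooth_functions.
Context {R : realType} {n : nat} (M : manifold R n).

Definition smooth_pred : {pred M -> R^o} := mem [set f | smooth_fun f].

(* [Cinfty] gets a [comPzRingType] and an [lmodType R] structure, related by
   [Cinfty_scalerAl] below. The library's algebra structures are not available
   because they exclude the zero ring, which is [Cinfty] of the empty manifold;
   an algebra homomorphism is therefore a ring morphism that is [scalable]. *)
Record Cinfty := SmoothFun {
  Cinfty_fun :> M -> R^o ;
  _ : Cinfty_fun \in smooth_pred
}.

HB.instance Definition _ := [isSub for Cinfty_fun].
HB.instance Definition _ := [Choice of Cinfty by <:].

Lemma smooth_pred_subring : subring_closed smooth_pred.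
Proof.
split=> [|f g|f g]; rewrite !inE/=.
- by move=> c _; exact: smooth_on_cst.
- by move=> sf sg c cM; apply: smooth_onB (sf _ cM) (sg _ cM); exact: open_cimg.
- by move=> sf sg c cM; apply: smooth_onM (sf _ cM) (sg _ cM); exact: open_cimg.
Qed.

HB.instance Definition _ :=
  GRing.isSubringClosed.Build (M -> R^o) smooth_pred smooth_pred_subring.
HB.instance Definition _ :=
  GRing.SubChoice_isSubComPzRing.Build (M -> R^o) smooth_pred Cinfty
    smooth_pred_subring.

Lemma smooth_pred_subsemimod : subsemimod_closed smooth_pred.
Proof.
split; first by split; [exact: rpred0|exact: rpredD].
move=> k f; rewrite !inE => sf c cM.
apply: smooth_onM (@smooth_on_cst _ _ (cimg c) k) (sf _ cM).
exact: open_cimg.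
Qed.

HB.instance Definition _ :=
  GRing.SubZmodule_isSubLmodule.Build R (M -> R^o) smooth_pred Cinfty
    smooth_pred_subsemimod.

Lemma Cinfty_scalerAl (k : R) (f g : Cinfty) : k *: (f * g) = (k *: f) * g.
Proof. by apply: val_inj; apply/funext => x; exact: mulrA. Qed.

End smooth_functions.

Arguments Cinfty {R n} M.

(* Main.v *)
From HB Require Import structures.
Require Import Defs.
From mathcomp Require Import all_boot all_order all_algebra.
From mathcomp Require Import all_classical all_reals all_analysis.
From mathcomp Require Import ring lra.
Import Order.TTheory GRing.Theory Num.Theory.
Import numFieldNormedType.Exports.
Local Open Scope classical_set_scope.
Local Open Scope ring_scope.

Set Implicit Arguments.
Unset Strict Implicit.
Unset Printing Implicit Defensive.

(** For q in N, the map f |-> pi f q is a character of C^oo(M). Every character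
chi is the evaluation at a point (Milnor): if f is a smooth proper function on M
then the zero set of f - chi f is compact, and the zero sets of the elements of
the kernel of chi form a filter base, because an element without zeros would be
invertible and because f^2 + g^2 vanishes exactly where f and g do. This gives
F : N -> M with pi f = f o F. Bump functions on M show that F is continuous, and
chart coordinates of M, multiplied by bump functions, show that it is smooth.
Since pi is surjective, every smooth function on N factors through F. Applied to
bump functions this makes F injective and open onto its image, applied to chart
coordinates it makes F an immersion, and applied to a proper function it makes F
proper. Then F(N) is closed, and carries the smooth structure of N. *)

(** * Calculus *)

Section flat.
Variable R : realType.
Implicit Types (p : {poly R}) (t : R).

(** The polynomial factor is there because every derivative of [exp(-1/t)], extended by [0], has
    this form. *)
Definition flat p t : R := if 0 < t then p.[t^-1] * expR (- t^-1) else 0.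

Lemma flat_gt0 t : 0 < t -> 0 < flat 1 t.
Proof. by move=> t0; rewrite /flat t0 hornerC mul1r expR_gt0. Qed.

Lemma flat_le0 p t : t <= 0 -> flat p t = 0.
Proof. by rewrite /flat leNgt => /negbTE ->. Qed.

Lemma flat_ge0 t : 0 <= flat 1 t.
Proof. by rewrite /flat; case: ifP => // _; rewrite hornerC mul1r expR_ge0. Qed.

(** The exponential series makes [exp(1/t)] dominate every power of [1/t]. In the induction,
    multiplying [p] by ['X] costs a factor [1/t], so the hypothesis is used with exponent [k.+1]. *)
Lemma flat_bound p k : exists2 C, 0 <= C & forall t, 0 < t -> `|flat p t| <= C * t ^+ k.
Proof.
elim/poly_ind: p k => [|p c IH] k.
  by exists 0 => // t t0; rewrite /flat t0 horner0 mul0r normr0 mul0r.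
have [C C0 HC] := IH k.+1.
exists (C + `|c| * k.+1`!%:R) => [|t t0]; first by rewrite addr_ge0// mulr_ge0.
have tV0 : 0 <= t^-1 by rewrite invr_ge0 ltW.
have key : t^-1 ^+ k <= k.+1`!%:R * expR t^-1.
  case: k {IH HC} => [|k].
    by rewrite expr0 factS fact0 mul1r (le_trans _ (expR_ge1Dx _))// lerDl.
  rewrite (@le_trans _ _ (k.+1`!%:R * expR t^-1))//; last first.
    by rewrite ler_wpM2r ?expR_ge0// ler_nat factS leq_pmull.
  rewrite mulrC -ler_pdivrMr ?ltr0n ?fact_gt0//.
  by rewrite (le_trans _ (expR_ge1Dxn k tV0))// lerDr.
have := HC t t0; rewrite /flat t0 !hornerE => Hp.
rewrite !mulrDl; apply: le_trans (ler_normD _ _) _; apply: lerD.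
  rewrite mulrAC normrM (ger0_norm tV0).
  by rewrite ler_pdivrMr// -mulrA -exprSr.
rewrite normrM -mulrA ler_wpM2l// ger0_norm ?expR_ge0// expRN.
rewrite -[leLHS]mul1r ler_pdivrMr ?expR_gt0// mulrAC.
by rewrite -ler_pdivrMr ?exprn_gt0// mul1r -exprVn.
Qed.

(** For [t > 0] this is the product rule with [d(1/t) = - t^-2 dt]. At [0] the bound with exponent
    [2] leaves a difference quotient of size at most [C * h]. *)
Lemma is_derive_flat p t :
  is_derive t 1 (flat p) (flat ('X^2 * (p - p^`())) t).
Proof.
have [t0|t0|->] := ltgtP t 0.
- rewrite flat_le0 ?(ltW t0)//.
  apply: (@near_eq_is_derive _ _ _ (cst (0 : R)) _ t 1 0 _ (is_derive_cst (0 : R) t 1)).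
  by near=> s; rewrite flat_le0//; near: s; exact: lt_le_nbhsl.
- have tn0 : t != 0 by rewrite gt_eqF.
  apply: (@near_eq_is_derive _ _ _ (fun t => p.[t^-1] * expR (- t^-1)) _ t 1).
    near=> s; have s0 : 0 < s by near: s; exact: lt_nbhsr.
    by rewrite /flat s0.
  have dV : is_derive t 1 (fun s : R => s^-1) (- t ^- 2).
    by have /= := @is_deriveV R id t 1 1 tn0 _; rewrite [_ *: _]mulr1; apply.
  have dp : is_derive t 1 (fun s : R => p.[s^-1]) (p^`().[t^-1] * - t ^- 2).
    exact: (@is_derive1_comp _ (horner p) _ _ _ _ (is_derive_poly _ _) dV).
  have dN : is_derive t 1 (fun s : R => - s^-1) (- - t ^- 2).
    exact: (@is_deriveN _ _ _ (fun s : R => s^-1)).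
  have de : is_derive t 1 (fun s : R => expR (- s^-1)) (expR (- t^-1) * - - t ^- 2).
    exact: (@is_derive1_comp _ expR _ _ _ _ (is_derive_expR _) dN).
  apply: (@is_derive_eq _ _ _ _ _ _ _ _ (is_deriveM dp de)).
  rewrite /flat t0 !hornerE/= exprVn opprK.
  by rewrite -![_ *: _]/(_ * _); ring.
rewrite flat_le0//.
have [C C0 HC] := flat_bound p 2.
have cv : (fun h => h^-1 *: ((flat p \o shift 0) (h *: 1) - flat p 0)) @ 0^' --> (0 : R).
  apply/cvgr0Pnorm_le => e e0; near=> h.
  have h0 : h != 0 by near: h; exact: nbhs_dnbhs_neq.
  rewrite /= addr0 [_ *: 1]mulr1 (@flat_le0 p 0)// subr0 -[_ *: _]/(_ * _).
  have [hn|hp] := leP h 0; first by rewrite flat_le0// mulr0 normr0 ltW.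
  rewrite normrM; have := HC h hp => Hh.
  rewrite normfV (gtr0_norm hp) mulrC ler_pdivrMr//.
  apply: (le_trans Hh); rewrite expr2 mulrA ler_pM2r//.
  (* The denominator is [C + 1] because [C] may be [0]. *)
  have hC : h < e / (C + 1).
    apply: (le_lt_trans (ler_norm _)); near: h; apply: dnbhs0_lt.
    by rewrite divr_gt0// ltr_pwDr.
  rewrite ltr_pdivlMr ?ltr_pwDr// in hC.
  by rewrite (le_trans _ (ltW hC))// mulrDr mulr1 mulrC lerDl ltW.
apply: DeriveDef; first exact: cvgP cv.
exact: cvg_lim cv.
Unshelve. all: by end_near. Qed.
End flat.

(** * Directional derivatives as derivatives of one variable *)

Section derivatives_along_lines.
Context {R : realType}.

Lemma growth_rate_line (V W : normedModType R) (f : V -> W) x v t :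
  (fun h : R => h^-1 *: ((f \o shift (t *: v + x)) (h *: v) - f (t *: v + x))) =
  (fun h : R => h^-1 *: (((fun s : R => f (s *: v + x)) \o shift t) (h *: 1) - f (t *: v + x))).
Proof. by apply/funext => h /=; rewrite [_ *: 1]mulr1 scalerDl -addrA. Qed.

Lemma is_derive_line (V W : normedModType R) (f : V -> W) x v t df :
  is_derive (t *: v + x) v f df <-> is_derive t 1 (fun s : R => f (s *: v + x)) df.
Proof.
split=> -[f1 f2]; apply: DeriveDef.
- by move: f1; rewrite /derivable growth_rate_line.
- by move: f2; rewrite /derive growth_rate_line.
- by rewrite /derivable growth_rate_line.
- by rewrite /derive growth_rate_line.
Qed.

(** Only a derivative in the direction [v] is given, so the one-variable chain rule is applied on
    the line through [x]. *)
Lemma is_derive_comp (V : normedModType R) (h : R -> R) (u : V -> R^o) x v dh du :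
  is_derive x v u du -> is_derive (u x) 1 h dh ->
  is_derive x v (h \o u : V -> R^o) (dh * du).
Proof.
move=> Du Dh.
have /is_derive_line Du0 : is_derive (0 *: v + x) v u du by rewrite scale0r add0r.
rewrite -[x in is_derive x](add0r x) -(scale0r v); apply/is_derive_line.
by apply: (@is_derive1_comp _ h (fun s : R => u (s *: v + x))); rewrite ?scale0r ?add0r.
Qed.

(** The endpoints come in either order because it is applied to coordinates of either sign. *)
Lemma mvt_bound (f : R -> R) (a b K : R) :
  (forall t, t \in `[Num.min a b, Num.max a b] -> derivable f t 1) ->
  (forall t, t \in `[Num.min a b, Num.max a b] -> `|'D_1 f t| <= K) ->
  `|f b - f a| <= K * `|b - a|.
Proof.
wlog ab : a b / a <= b => [hw df bf|].
  have [ab|/ltW ba] := leP a b; first exact: hw.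
  by rewrite distrC (distrC b); apply: hw => // t; rewrite minC maxC; [exact: df|exact: bf].
rewrite min_l// max_r// => df bf.
have [t tab ->] : exists2 c, c \in `[a, b]%R & f b - f a = 'D_1 f c * (b - a).
  apply: MVT_segment => // [t /subset_itv_oo_cc /df /derivableP//|].
  by apply: derivable_within_continuous => t /df.
by rewrite normrM ler_wpM2r// bf.
Qed.

End derivatives_along_lines.

(** * Operations that preserve smoothness on open sets *)

Section smooth_on_closure.
Context {R : realType} {n : nat}.
Implicit Types (U V : set 'rV[R]_n) (f g u : 'rV[R]_n -> R^o).

Lemma smooth_on_derivable U f x i :
  smooth_on U f -> U x -> derivable f x (delta_mx 0 i).
Proof. by move=> sf Ux; have [_] := sf [::] x Ux. Qed.

Lemma smooth_on_continuous U f x : smooth_on U f -> U x -> {for x, continuous f}.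
Proof. by move=> sf Ux; have [] := sf [::] x Ux. Qed.

Lemma smooth_on_local U f :
  (forall x, U x -> exists2 V, V x & smooth_on V f) -> smooth_on U f.
Proof. by move=> loc s x /loc [V Vx sV]; exact: sV. Qed.

Lemma smooth_on_sub U V f : V `<=` U -> smooth_on U f -> smooth_on V f.
Proof. by move=> VU sf s x /VU; exact: sf. Qed.

Lemma smooth_on_eq U f g : open U -> {in U, f =1 g} -> smooth_on U f -> smooth_on U g.
Proof.
move=> oU fg sf; apply: sum_of_prods_smooth => //.
apply: (SProd (@smooth_on_cst _ _ U 1) sf) => x Ux.
by rewrite -fg ?inE// -[RHS]/(1 * f x) mul1r.
Qed.

Lemma smooth_on_add U f g : open U -> smooth_on U f -> smooth_on U g -> smooth_on U (f + g).
Proof.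
move=> oU sf sg; have -> : f + g = f - (cst 0 - g).
  by apply/funext => x; rewrite /= !fctE sub0r opprK.
by do 2?[apply: smooth_onB => //]; exact: smooth_on_cst.
Qed.

Lemma is_derive_coord (j : 'I_n) x v :
  is_derive x v (fun y : 'rV[R]_n => y 0 j : R^o) (v 0 j).
Proof.
rewrite -[x]add0r -(scale0r v); apply/is_derive_line.
have -> : (fun s : R => (s *: v + x) 0 j) = (v 0 j \*: @id R) + cst (x 0 j).
  by apply/funext => s; rewrite !mxE fctE /= mulrC.
rewrite -[X in is_derive _ _ _ X]addr0; apply: is_deriveD.
by rewrite -[X in is_derive _ _ _ X]mulr1; exact: is_deriveZ.
Qed.

Section composition.
Variables (U : set 'rV[R]_n) (W : set R) (Q : set (R -> R)) (u : 'rV[R]_n -> R^o).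
Hypothesis oU : open U.
Hypothesis QD : forall h, Q h -> exists2 h', Q h' & forall t, W t -> is_derive t 1 h (h' t).
Hypothesis su : smooth_on U u.
Hypothesis uW : forall x, U x -> W (u x).

(* By the chain rule, this class is stable under partial derivatives. *)
Inductive comp_sum (g : 'rV[R]_n -> R^o) : Prop :=
| CompProd h w of Q h & smooth_on U w & (forall x, U x -> g x = ((h \o u) * w) x)
| CompSum g1 g2 of comp_sum g1 & comp_sum g2 & (forall x, U x -> g x = (g1 + g2) x).

Let near_in (x : 'rV[R]_n) (f g : 'rV[R]_n -> R^o) :
  U x -> (forall y, U y -> f y = g y) -> \forall y \near x, g y = f y.
Proof.
by move=> Ux fg; have := open_nbhs_nbhs (conj oU Ux); apply: filterS => y /fg.
Qed.

Let comp_deriv h h' x i : (forall t, W t -> is_derive t 1 h (h' t)) -> U x ->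
  is_derive x (delta_mx 0 i) (h \o u : _ -> R^o) (h' (u x) * 'D_(delta_mx 0 i) u x).
Proof.
move=> Dh Ux; apply: is_derive_comp (Dh _ (uW Ux)).
by apply/derivableP; exact: smooth_on_derivable su Ux.
Qed.

Let comp_cont h x : Q h -> U x -> {for x, continuous (h \o u)}.
Proof.
move=> /QD [h' _ Dh] Ux; apply: continuous_comp; first exact: smooth_on_continuous su Ux.
apply: differentiable_continuous; apply/derivable1_diffP.
by have [] := Dh _ (uW Ux).
Qed.

Let comp_reg g : comp_sum g -> forall x, U x ->
  {for x, continuous g} /\ forall i, derivable g x (delta_mx 0 i).
Proof.
elim=> {}g.
- move=> h w Qh sw gE x Ux; have E := near_in Ux gE.
  have [h' _ Dh] := QD Qh; split.
    rewrite /prop_for /continuous_at (gE _ Ux).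
    apply: cvg_trans; first exact: near_eq_cvg E.
    exact: cvgM (comp_cont Qh Ux) (smooth_on_continuous sw Ux).
  move=> i; apply: near_eq_derivable E _; apply: derivableM.
    by have [] := comp_deriv i Dh Ux.
  exact: smooth_on_derivable sw Ux.
- move=> f1 f2 _ r1 _ r2 gE x Ux; have E := near_in Ux gE.
  have [c1 d1] := r1 x Ux; have [c2 d2] := r2 x Ux; split.
    rewrite /prop_for /continuous_at (gE _ Ux).
    by apply: cvg_trans; [exact: near_eq_cvg E|exact: cvgD c1 c2].
  by move=> i; apply: near_eq_derivable E _; exact: derivableD.
Qed.

(** [Q] is a class of one-variable functions closed under differentiation on [W], which stands in
    for smoothness of [h]. Sums of terms [(h \o u) * w] then have partial derivatives of the same
    form. *)
Lemma smooth_on_comp h : Q h -> smooth_on U (h \o u).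
Proof.
move=> Qh; apply: (@smooth_on_coind _ _ _ comp_sum); first exact: comp_reg.
  move=> g i; elim=> {Qh h} {}g.
  - move=> h w Qh sw gE; have [h' Qh' Dh] := QD Qh.
    have sDu := smooth_onD i su; have sDw := smooth_onD i sw.
    apply: (@CompSum _ ((h' \o u) * ('D_(delta_mx 0 i) u * w)) ((h \o u) * 'D_(delta_mx 0 i) w)).
    + exact: CompProd Qh' (smooth_onM oU sDu sw) _.
    + exact: CompProd Qh sDw _.
    move=> x Ux; have Dhu := comp_deriv i Dh Ux.
    rewrite -(near_eq_derive _ (near_in Ux gE)) deriveM.
    + rewrite (@derive_val _ _ _ _ _ _ _ Dhu) !fctE /= addrC; congr (_ + _).
      by rewrite -[LHS]/(_ * _) mulrCA [w x * _]mulrC.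
    + by have [] := Dhu.
    + exact: smooth_on_derivable sw Ux.
  - move=> f1 f2 p1 D1 p2 D2 gE; apply: CompSum D1 D2 _ => x Ux.
    rewrite -(near_eq_derive _ (near_in Ux gE)) deriveD//.
    + by have [_] := comp_reg p1 Ux; apply.
    + by have [_] := comp_reg p2 Ux; apply.
apply: (CompProd Qh (@smooth_on_cst _ _ U 1)) => x _.
by rewrite !fctE mulr1.
Qed.

End composition.

Lemma smooth_on_flat U u : open U -> smooth_on U u -> smooth_on U (flat 1 \o u).
Proof.
move=> oU su; apply: (@smooth_on_comp U setT (range (@flat R))) => //.
by move=> _ [p _ <-]; exists (flat ('X^2 * (p - p^`()))) => // t _; exact: is_derive_flat.
Qed.

Lemma smooth_on_inv U u : open U -> smooth_on U u -> (forall x, U x -> u x != 0) ->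
  smooth_on U (fun x => (u x)^-1).
Proof.
move=> oU su u0.
(* The multiples of the powers of [1/t], a class closed under differentiation away from [0]. *)
pose Q : set (R -> R) := [set h | exists c k, h = fun t => c * t^-1 ^+ k].
have -> : (fun x => (u x)^-1) = (fun t : R => t^-1) \o u by [].
apply: (@smooth_on_comp U [set t | t != 0] Q) => //; last first.
  by exists 1, 1%N; apply/funext => t; rewrite mul1r.
move=> _ [c [k ->]]; exists (fun t => - c * k%:R * t^-1 ^+ k.+1); first by exists (- c * k%:R), k.+1.
move=> t t0.
have dV : is_derive t 1 (fun s : R => s^-1) (- t ^- 2).
  by have /= := @is_deriveV R id t 1 1 t0 _; rewrite [_ *: _]mulr1; apply.
have -> : (fun t => c * t^-1 ^+ k) = c \*: (fun s : R => s^-1) ^+ k.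
  by apply/funext => s; rewrite /= exprfctE.
apply: is_derive_eq (is_deriveZ c (is_deriveX k dV)) _; rewrite -![_ *: _]/(_ * _) -mulr_natr.
case: k => [|k]; first by rewrite !mulr0 !mul0r mulr0.
rewrite /= -exprVn; move: (t^-1) => y.
by rewrite !mul1r -[k.+2]addn2 exprD !(mulrN, mulNr) !mulrA.
Qed.

End smooth_on_closure.

(** * Continuous partial derivatives imply differentiability *)

Section C1_differentiable.
Context {R : realType}.

Lemma norm_coord n (v : 'rV[R]_n) (i : 'I_n) : `|v 0 i| <= `|v|.
Proof. by rewrite [leRHS]/Num.norm /= mx_normrE; exact: (le_bigmax _ _ (0, i)). Qed.

Lemma norm_le_coord n (v : 'rV[R]_n) (K : R) :
  0 <= K -> (forall i, `|v 0 i| <= K) -> `|v| <= K.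
Proof.
move=> K0 vK; rewrite [leLHS]/Num.norm /= mx_normrE.
by apply/bigmax_leP; split => // -[a i] _ /=; rewrite ord1.
Qed.

Variable n : nat.
Implicit Types (f : 'rV[R]_n -> R^o) (x v : 'rV[R]_n).

(** For [k] from [0] to [n] these are the corners of a path from [0] to [v] along the coordinate
    directions. *)
Definition head_mx (v : 'rV[R]_n) k : 'rV[R]_n := \row_j (if (j < k)%N then v 0 j else 0).

Lemma head_mx0 v : head_mx v 0 = 0.
Proof. by apply/rowP => j; rewrite !mxE. Qed.

Lemma head_mxn v : head_mx v n = v.
Proof. by apply/rowP => j; rewrite !mxE ltn_ord. Qed.

Lemma head_mxS v (i : 'I_n) : head_mx v i.+1 = v 0 i *: delta_mx 0 i + head_mx v i.
Proof.
apply/rowP => j; rewrite !mxE eqxx /= ltnS leq_eqVlt -val_eqE /=.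
have [/val_inj->|_] := eqVneq (val j) (val i); last by rewrite mulr0 add0r.
by rewrite ltnn mulr1 addr0.
Qed.

Lemma norm_head_mx v (i : 'I_n) t : `|t| <= `|v| ->
  `|t *: delta_mx 0 i + head_mx v i| <= `|v|.
Proof.
move=> tv; apply: norm_le_coord => // j; rewrite !mxE eqxx /=.
have [->|_] := eqVneq j i; first by rewrite ltnn mulr1 addr0.
by rewrite mulr0 add0r; case: ifP => _; [exact: norm_coord|rewrite normr0].
Qed.

(* Go from [x] to [v + x] by changing one coordinate at a time. *)
Lemma norm_sub_partial f x (e K : R) v :
  (forall y, `|y - x| < e -> forall i, derivable f y (delta_mx 0 i)) ->
  (forall y, `|y - x| < e -> forall i, `|'D_(delta_mx 0 i) f y| <= K) ->
  `|v| < e -> `|f (v + x) - f x| <= n%:R * (K * `|v|).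
Proof.
move=> df bf ve.
have step (i : 'I_n) :
    `|f (head_mx v i.+1 + x) - f (head_mx v i + x)| <= K * `|v|.
  pose g (t : R) := f (t *: delta_mx 0 i + (head_mx v i + x)).
  (* The norm is the maximum of the coordinates, so no point of this edge is farther from [x] than
     [|v|]. *)
  have inb t : t \in `[Num.min 0 (v 0 i), Num.max 0 (v 0 i)] ->
      `|(t *: delta_mx 0 i + (head_mx v i + x)) - x| < e.
    rewrite in_itv /= => /andP[t1 t2]; rewrite addrA addrK.
    apply: le_lt_trans ve; apply: norm_head_mx.
    apply: le_trans (norm_coord v i); rewrite ler_norml.
    move: t1 t2; have [v0|v0] := leP 0 (v 0 i).
      rewrite ?(min_l v0) ?(max_r v0) ger0_norm// => t1 ->.
      by rewrite andbT (le_trans _ t1)// oppr_le0.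
    rewrite ler0_norm ?(ltW v0)// opprK => -> t2 /=.
    by rewrite (le_trans t2)// oppr_ge0 ltW.
  have := @mvt_bound R g 0 (v 0 i) K.
  rewrite /g scale0r add0r subr0 addrA -head_mxS; move=> key.
  apply: le_trans (key _ _) _.
  - by move=> t /inb tb; have /derivableP/is_derive_line[] := df _ tb i.
  - move=> t /inb tb; have /derivableP/is_derive_line[_ ->] := df _ tb i.
    exact: bf.
  - rewrite ler_wpM2l ?norm_coord//.
    by apply: le_trans (bf x _ i); rewrite ?subrr ?normr0// (le_lt_trans _ ve).
rewrite -{1}(head_mxn v) -{2}[x]add0r -{1}(head_mx0 v).
rewrite -(@telescope_sumr _ 0 n (fun k => f (head_mx v k + x)))// big_mkord.
apply: le_trans (ler_norm_sum _ _ _) _.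
apply: le_trans (ler_sum _ (fun i _ => step i)) _.
by rewrite sumr_const card_ord mulr_natl.
Qed.

(** Let [L] be the linear map given by the partial derivatives at [x]. Those of [f - L] are small
    near [x], so [norm_sub_partial] bounds its increments by a small multiple of the step. *)
Lemma C1_differentiable f x (U : set 'rV[R]_n) : open U -> U x ->
  (forall y, U y -> forall i, derivable f y (delta_mx 0 i)) ->
  (forall i, {for x, continuous ('D_(delta_mx 0 i) f)}) ->
  differentiable f x.
Proof.
move=> oU Ux df cf.
pose L v : R^o := \sum_i v 0 i *: ('D_(delta_mx 0 i) f x).
have L_lin : linear L.
  move=> a u v; rewrite /L scaler_sumr -big_split /=; apply: eq_bigr => i _.
  by rewrite !mxE scalerDl scalerA.
pose LL : {linear 'rV[R]_n -> R^o} := HB.pack L (GRing.isLinear.Build _ _ _ _ _ L_lin).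
have dcoord (y : 'rV[R]_n) (i : 'I_n) : differentiable (fun v : 'rV[R]_n => v 0 i *: ('D_(delta_mx 0 i) f x)) y.
  by apply: differentiableZl; exact: differentiable_coord.
have LE : L = \sum_(i < n) (fun v => v 0 i *: ('D_(delta_mx 0 i) f x)).
  by apply/funext => v; rewrite fct_sumE.
have dL y : differentiable L y.
  by rewrite LE; apply: differentiable_sum => i; exact: dcoord.
have LLc : continuous LL by move=> y; exact: differentiable_continuous (dL y).
suff H : f \o shift x = cst (f x) + (LL : _ -> _) +o_ (0 : 'rV[R]_n) id.
  apply/diff_locallyP; rewrite (diff_unique LLc H); split => //.
have DL y i : 'D_(delta_mx 0 i) L y = 'D_(delta_mx 0 i) f x.
  rewrite deriveE// (_ : L = LL)// diff_lin//= /L (bigD1 i)//= big1 => [|j /negPf ji].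
    by rewrite !mxE !eqxx scale1r addr0.
  by rewrite !mxE eqxx ji scale0r.
apply/eqaddoP => e e0.
(* The [n] coordinate steps contribute this much each, in total at most [e]; [n.+1] keeps the
   quotient positive when [n = 0]. *)
have e'0 : 0 < e / n.+1%:R by rewrite divr_gt0.
have nDf i : \forall y \near x, `|'D_(delta_mx 0 i) f y - 'D_(delta_mx 0 i) f x| <= e / n.+1%:R.
  by have /cvgrPdistC_le := cf i; exact.
have : \forall y \near x, U y /\ forall i, `|'D_(delta_mx 0 i) f y - 'D_(delta_mx 0 i) f x| <= e / n.+1%:R.
  near=> y; split; near: y; first exact: open_nbhs_nbhs.
  exact: (filter_forall _ nDf).
move=> /nbhs_normP[d /= d0 Hd].
have Hd' y : `|y - x| < d -> U y /\ forall i, `|'D_(delta_mx 0 i) f y - 'D_(delta_mx 0 i) f x| <= e / n.+1%:R.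
  by rewrite distrC; exact: Hd.
have nb0 : \forall h \near (0 : 'rV[R]_n), `|h| < d by exact: nbhs0_lt.
apply: filterS nb0 => h hd.
have dLi y i : derivable L y (delta_mx 0 i) by apply: diff_derivable.
have := @norm_sub_partial (f - L) x d (e / n.+1%:R) h _ _ hd.
rewrite !fctE /= (_ : f (h + x) - L (h + x) - (f x - L x) = f (h + x) - (f x + L h)); last first.
  have -> : L (h + x) = L h + L x by exact: (linearD LL).
  by rewrite !opprD !opprK; ring.
move=> key; apply: le_trans (key _ _) _.
- by move=> y /Hd'[Uy _] i; apply: derivableB; [exact: df|exact: dLi].
- by move=> y /Hd'[Uy Dy] i; rewrite deriveB ?DL//; exact: df.
rewrite mulrA ler_wpM2r// mulrCA ler_piMr ?(ltW e0)//.
by rewrite ler_pdivrMr ?ltr0n// mul1r ler_nat.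
Unshelve. all: by end_near. Qed.

End C1_differentiable.

(** * A smooth cutoff function *)

Section plateau.
Context {R : realType}.

Lemma flat_le (s t : R) : s <= t -> flat 1 s <= flat 1 t.
Proof.
move=> st; have [s0|s0] := leP s 0; first by rewrite flat_le0// flat_ge0.
have t0 := lt_le_trans s0 st; rewrite /flat s0 t0 !hornerC !mul1r ler_expR lerN2.
by rewrite lef_pV2 ?posrE.
Qed.

(* Nesting the flat function gives a function that is constant near [0]
   without any quotient of smooth functions. *)
Definition plateau (e t : R) : R :=
  flat 1 (1 - (flat 1 (e / 2))^-1 * flat 1 (t - e / 2)) * (flat 1 1)^-1.

Lemma plateau1 (e t : R) : t <= e / 2 -> plateau e t = 1.
Proof.
move=> te; rewrite /plateau (@flat_le0 _ _ (t - _)) ?subr_le0// mulr0 subr0.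
by rewrite divff// gt_eqF// flat_gt0.
Qed.

(** At [t = e] the normalized inner term is [1]; by monotonicity it is at least [1] beyond, where
    the outer [flat] vanishes. *)
Lemma plateau0 (e t : R) : 0 < e -> e <= t -> plateau e t = 0.
Proof.
move=> e0 et; have f0 : 0 < flat 1 (e / 2) by rewrite flat_gt0// divr_gt0.
rewrite /plateau flat_le0 ?mul0r// subr_le0 mulrC ler_pdivlMr// mul1r.
by apply: flat_le; lra.
Qed.

Lemma smooth_on_plateau n (U : set 'rV[R]_n) u e : open U -> smooth_on U u ->
  smooth_on U (fun x => plateau e (u x)).
Proof.
move=> oU su.
have s1 : smooth_on U (u - cst (e / 2)) by apply: smooth_onB => //; exact: smooth_on_cst.
have s2 := smooth_onM oU (@smooth_on_cst _ _ U (flat 1 (e / 2))^-1) (smooth_on_flat oU s1).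
have s3 := smooth_on_flat oU (smooth_onB oU (@smooth_on_cst _ _ U 1) s2).
exact: smooth_onM oU s3 (@smooth_on_cst _ _ U (flat 1 1)^-1).
Qed.

End plateau.

Section smooth_differentiable.
Context {R : realType}.

Lemma smooth_on_differentiable n (U : set 'rV[R]_n) f x :
  open U -> smooth_on U f -> U x -> differentiable f x.
Proof.
move=> oU sf Ux; apply: (@C1_differentiable _ _ _ _ U) => //.
  by move=> y Uy i; exact: smooth_on_derivable sf Uy.
by move=> i; exact: smooth_on_continuous (smooth_onD i sf) Ux.
Qed.

Lemma smooth_map_on_differentiable n m (U : set 'rV[R]_n) (F : 'rV[R]_n -> 'rV[R]_m) x :
  open U -> smooth_map_on U F -> U x -> differentiable F x.
Proof.
move=> oU sF Ux; have -> : F = \sum_(j < m) (fun y => F y 0 j *: delta_mx 0 j).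
  by apply/funext => y; rewrite fct_sumE [LHS]row_sum_delta.
apply: differentiable_sum => j; apply: differentiableZl.
exact: smooth_on_differentiable (sF j) Ux.
Qed.

End smooth_differentiable.

(** * Smooth functions on manifolds *)

Section smooth_fun_on.
Context {R : realType} {n : nat} {M : manifold R n}.
Implicit Types (V W : set M) (f g : M -> R^o).

Definition smooth_fun_on V f :=
  forall c, charts c -> smooth_on (cmap c @` (cdom c `&` V)) (f \o cinv c).

Lemma chart_cover (x : M) : exists2 c, charts c & cdom c x.
Proof. exact: atlas_cover. Qed.

Lemma near_cinv (c : chart R n M) V x : open V -> cdom c x -> V x ->
  \forall v \near cmap c x, (cmap c @` (cdom c `&` V)) v.
Proof.
move=> oV cx Vx.
have cix : cimg c (cmap c x) by exists x.
have nV : nbhs (cmap c x) (cinv c @^-1` V).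
  by apply: (cinv_continuous cix); rewrite cmapK//; exact: open_nbhs_nbhs.
have nI : nbhs (cmap c x) (cimg c).
  by apply: open_nbhs_nbhs; split => //; exact: open_cimg.
apply: filterS (filterI nI nV) => _ [[y cy <-]] /=; rewrite cmapK// => Vy.
by exists y.
Qed.

Lemma open_chart_img (c : chart R n M) V : open V -> open (cmap c @` (cdom c `&` V)).
Proof. by move=> oV; rewrite openE => _ [x [cx Vx] <-]; exact: near_cinv. Qed.

Lemma smooth_fun_onT f : smooth_fun_on setT f <-> smooth_fun f.
Proof. by split=> sf c cM; have := sf c cM; rewrite setIT. Qed.

Lemma smooth_fun_on_sub V W f : W `<=` V -> smooth_fun_on V f -> smooth_fun_on W f.
Proof.
move=> WV sf c cM; apply: smooth_on_sub (sf c cM).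
by apply: image_subset => x [cx /WV].
Qed.

Lemma smooth_fun_on_local V f :
  (forall x, V x -> exists2 W, W x & smooth_fun_on W f) -> smooth_fun_on V f.
Proof.
move=> loc c cM; apply: smooth_on_local => _ [x [cx Vx] <-].
have [W Wx sW] := loc x Vx.
by exists (cmap c @` (cdom c `&` W)); [exists x|exact: sW].
Qed.

Lemma smooth_fun_on_eq V f g : open V -> (forall x, V x -> f x = g x) ->
  smooth_fun_on V f -> smooth_fun_on V g.
Proof.
move=> oV fg sf c cM; apply: smooth_on_eq (sf c cM); first exact: open_chart_img.
by move=> _ /set_mem[x [cx Vx] <-]; rewrite /= cmapK// fg.
Qed.

Lemma smooth_fun_near f :
  (forall x : M, exists2 g, smooth_fun g & \forall y \near x, f y = g y) -> smooth_fun f.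
Proof.
move=> loc; apply/smooth_fun_onT; apply: smooth_fun_on_local => x _.
have [g /smooth_fun_onT sg fgx] := loc x.
have : nbhs x [set y | f y = g y] by exact: fgx.
rewrite nbhsE => -[V [oV Vx] fg].
exists V => //; apply: (@smooth_fun_on_eq _ g) => // [y Vy|]; first by rewrite fg.
exact: smooth_fun_on_sub sg.
Qed.

Lemma smooth_fun_on_cst V (k : R) : smooth_fun_on V (fun=> k).
Proof. by move=> c cM; exact: smooth_on_cst. Qed.

Lemma smooth_fun_onM V f g : open V -> smooth_fun_on V f -> smooth_fun_on V g ->
  smooth_fun_on V (fun x => f x * g x).
Proof.
move=> oV sf sg c cM; have oc := open_chart_img (c := c) oV.
exact: smooth_onM oc (sf c cM) (sg c cM).
Qed.

Lemma smooth_fun_onB V f g : open V -> smooth_fun_on V f -> smooth_fun_on V g ->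
  smooth_fun_on V (fun x => f x - g x).
Proof.
move=> oV sf sg c cM; have oc := open_chart_img (c := c) oV.
exact: smooth_onB oc (sf c cM) (sg c cM).
Qed.

Lemma smooth_fun_onD V f g : open V -> smooth_fun_on V f -> smooth_fun_on V g ->
  smooth_fun_on V (fun x => f x + g x).
Proof.
move=> oV sf sg c cM; have oc := open_chart_img (c := c) oV.
exact: smooth_on_add oc (sf c cM) (sg c cM).
Qed.

Lemma smooth_fun_on_sum (I : Type) (r : seq I) (F : I -> M -> R^o) V : open V ->
  (forall i, smooth_fun_on V (F i)) -> smooth_fun_on V (fun x => \sum_(i <- r) F i x).
Proof.
move=> oV sF; elim: r => [|i r IH].
  by rewrite (_ : (fun _ => _) = fun=> 0); [exact: smooth_fun_on_cst|apply/funext => x; rewrite big_nil].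
rewrite (_ : (fun _ => _) = fun x => F i x + \sum_(j <- r) F j x); first exact: smooth_fun_onD.
by apply/funext => x; rewrite big_cons.
Qed.

Lemma smooth_fun_on_prod (I : Type) (r : seq I) (F : I -> M -> R) V : open V ->
  (forall i, smooth_fun_on V (F i)) -> smooth_fun_on V (fun x => \prod_(i <- r) F i x).
Proof.
move=> oV sF; elim: r => [|i r IH].
  by rewrite (_ : (fun _ => _) = fun=> 1); [exact: smooth_fun_on_cst|apply/funext => x; rewrite big_nil].
rewrite (_ : (fun _ => _) = fun x => F i x * \prod_(j <- r) F j x); first exact: smooth_fun_onM.
by apply/funext => x; rewrite big_cons.
Qed.

Lemma smooth_fun_on_plateau V e f : open V -> smooth_fun_on V f ->
  smooth_fun_on V (fun x => plateau e (f x)).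
Proof.
move=> oV sf c cM; have oc := open_chart_img (c := c) oV.
exact: smooth_on_plateau oc (sf c cM).
Qed.

Lemma smooth_funV f : smooth_fun f -> (forall x, f x != 0) -> smooth_fun (fun x => (f x)^-1).
Proof.
move=> sf f0 c cM; apply: (@smooth_on_inv _ _ (cimg c) (f \o cinv c)) => //.
- exact: open_cimg.
- exact: sf.
- by move=> v _; exact: f0.
Qed.

Lemma smooth_fun_on_coord d j : charts d -> smooth_fun_on (cdom d) (fun x => cmap d x 0 j).
Proof. by move=> dM c cM; exact: (atlas_compatible cM dM). Qed.

Lemma smooth_fun_on_continuous V f x : open V -> smooth_fun_on V f -> V x ->
  {for x, continuous f}.
Proof.
move=> oV sf Vx; have [c cM cx] := chart_cover x.
have fcE : \forall y \near x, (f \o cinv c) (cmap c y) = f y.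
  have : nbhs x (cdom c) by apply: open_nbhs_nbhs; split => //; exact: open_cdom.
  by apply: filterS => y cy /=; rewrite cmapK.
rewrite /prop_for /continuous_at; apply: cvg_trans; first exact: (near_eq_cvg fcE).
rewrite -[f x](nbhs_singleton fcE).
apply: (@continuous_comp _ _ _ (cmap c) (f \o cinv c) x); first exact: cmap_continuous.
by apply: smooth_on_continuous (sf c cM) _; exists x.
Qed.

Lemma smooth_fun_continuous f : smooth_fun f -> continuous f.
Proof. by move=> /smooth_fun_onT sf x; exact: smooth_fun_on_continuous openT sf _. Qed.

End smooth_fun_on.

(** * Bump functions and an exhaustion function *)

Section bump.
Context {R : realType} {n : nat} {M : manifold R n}.
Implicit Types (V W K : set M) (f g : M -> R^o).

(** [V] and the complement of [K] are open and cover [M], and [g] is smooth on each, being [0] on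
    the second. *)
Lemma smooth_fun_zero_off V K g : open V -> closed K -> K `<=` V ->
  smooth_fun_on V g -> (forall x, ~ K x -> g x = 0) -> smooth_fun g.
Proof.
move=> oV cK KV sg g0; apply/smooth_fun_onT; apply: smooth_fun_on_local => x _.
have [/KV Vx|nKx] := pselect (K x); first by exists V.
exists (~` K) => //; apply: (@smooth_fun_on_eq _ _ _ _ (fun=> 0)).
- exact: closed_openC.
- by move=> y /g0.
- exact: smooth_fun_on_cst.
Qed.

(** A cutoff of the squared distance in a chart, extended by [0]. Its support lies in the image [K]
    of a closed ball, which is compact, hence closed as [M] is Hausdorff; this makes the extension
    smooth. *)
Lemma bump V x : open V -> V x -> exists g K,
  [/\ smooth_fun g, compact K, K `<=` V, (forall y, ~ K y -> g y = 0) &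
      \forall y \near x, g y = 1].
Proof.
move=> oV Vx; have [c cM cx] := chart_cover x.
pose a := cmap c x.
have := near_cinv oV cx Vx; rewrite -/a => /nbhs_normP[r /= r0 Hr].
pose e := r / 2; have e0 : 0 < e by rewrite divr_gt0.
pose B : set 'rV[R]_n := [set v | `|v - a| <= e].
have BV : B `<=` cmap c @` (cdom c `&` V).
  move=> v /= Bv; apply: Hr => /=; rewrite distrC (le_lt_trans Bv)//.
  by rewrite /e ltr_pdivrMr// mulr_natr mulr2n ltrDl.
have cB : compact B.
  apply: bounded_closed_compact.
    exists (`|a| + e); split; first exact: num_real.
    move=> s sae v /= Bv; rewrite (le_trans _ (ltW sae))//.
    by rewrite -[v](subrK a) addrC (le_trans (ler_normD _ _))// lerD2l.
  rewrite (_ : B = (fun v => `|v - a|) @^-1` [set t | t <= e]); last by [].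
  apply: closed_comp; last exact: closed_le.
  move=> v _; have cva : y - a @[y --> v] --> v - a.
    exact: (cvgB (@cvg_id _ (nbhs v)) (@cvg_cst _ a _ (nbhs v) _)).
  exact: cvg_norm cva.
pose K := cinv c @` B.
have KV : K `<=` V by move=> _ [v /BV[y [cy Vy] <-] <-]; rewrite cmapK.
have Kc : K `<=` cdom c by move=> _ [v /BV[y [cy Vy] <-] <-]; rewrite cmapK.
have cK : compact K.
  apply: continuous_compact => //; apply: continuous_in_subspaceT => v /set_mem /BV[y [cy _] yv].
  by apply: cinv_continuous; exists y.
(* The squared Euclidean distance is used because the norm, a maximum, need not be smooth. *)
pose u y := \sum_(j < n) (cmap c y 0 j - a 0 j) * (cmap c y 0 j - a 0 j).
have su : smooth_fun_on (cdom c) (u : M -> R^o).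
  have oc := open_cdom c.
  apply: smooth_fun_on_sum => // j; apply: smooth_fun_onM => //; apply: smooth_fun_onB => //;
    by [exact: smooth_fun_on_coord|exact: smooth_fun_on_cst].
pose g y : R^o := if y \in cdom c then plateau (e * e) (u y) else 0.
have g0 y : ~ K y -> g y = 0.
  move=> nKy; rewrite /g; case: ifPn => // /set_mem cy.
  apply: plateau0; first exact: mulr_gt0.
  (* If [u y < e * e], every coordinate is within [e] of that of [a], which puts [y] in [K]. *)
  rewrite leNgt; apply/negP => uy; apply: nKy; exists (cmap c y); last exact: cmapK.
  apply: norm_le_coord; first exact: ltW.
  move=> j; rewrite !mxE -ler_sqr ?nnegrE ?(ltW e0)// real_normK ?num_real// !expr2.
  apply: le_trans (ltW uy); rewrite /u (bigD1 j)//= lerDl.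
  by apply: sumr_ge0 => i _; rewrite -expr2 sqr_ge0.
exists g, K; split => //.
- apply: (@smooth_fun_zero_off (cdom c) K) => //.
  + exact: open_cdom.
  + by apply: compact_closed cK; exact: hausdorff_manifold.
  apply: (@smooth_fun_on_eq _ _ _ _ (fun y => plateau (e * e) (u y))).
  + exact: open_cdom.
  + by move=> y cy; rewrite /g mem_set.
  + by apply: smooth_fun_on_plateau => //; exact: open_cdom.
- have ux : u x = 0 by rewrite /u big1// => j _; rewrite subrr mul0r.
  have := smooth_fun_on_continuous (open_cdom c) su cx.
  have e20 : 0 < e * e / 2 by rewrite divr_gt0 ?mulr_gt0.
  move=> /cvgrPdist_lt /(_ _ e20); rewrite ux => H.
  have nc : \forall y \near x, cdom c y.
    by apply: open_nbhs_nbhs; split => //; exact: open_cdom.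
  apply: filterS2 H nc => y; rewrite sub0r normrN => uy cy.
  by rewrite /g mem_set// plateau1// (le_trans (ler_norm _))// ltW.
Qed.

(** Multiplying by a bump function supported in [V] keeps the values near [x] and removes those
    outside [V]. *)
Lemma smooth_fun_extend V g x : open V -> V x -> smooth_fun_on V g ->
  exists2 f, smooth_fun f & \forall y \near x, f y = g y.
Proof.
move=> oV Vx sg; have [h [K [sh cK KV h0 h1]]] := bump oV Vx.
exists (fun y => h y * g y); last by apply: filterS h1 => y ->; rewrite mul1r.
apply: (@smooth_fun_zero_off V K) => //.
- by apply: compact_closed cK; exact: hausdorff_manifold.
- by apply: smooth_fun_onM => //; apply: smooth_fun_on_sub (iffRL (smooth_fun_onT _) sh).
- by move=> y /h0 ->; rewrite mul0r.
Qed.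

(** Second countability yields countably many compactly supported [psi k] such that near each point
    one of them is [1]. The function [f] grows with the number of initial [psi k] that vanish at the
    point. *)
Lemma proper_smooth_fun : exists2 f : M -> R^o, smooth_fun f &
  forall c : R, compact [set x | f x <= c].
Proof.
have [B cB [Bo Bb]] := second_countable_manifold M.
have /countable_injP[e einj] := cB.
pose bumpon (b : set M) (h : M -> R^o) := exists K,
  [/\ smooth_fun h, compact K, (forall y, ~ K y -> h y = 0) & forall y, b y -> h y = 1].
(* [e] numbers the base injectively. The [k]-th function is a bump equal to [1] on the base set
   numbered [k] if there is one, and [0] otherwise. *)
have ex_psi (k : nat) : exists hK : (M -> R^o) * set M,
    [/\ smooth_fun hK.1, compact hK.2, (forall y, ~ hK.2 y -> hK.1 y = 0) &
      forall b, B b -> e b = k -> (exists h, bumpon b h) -> forall y, b y -> hK.1 y = 1].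
  have [[b [Bb' <- [h [K [sh cK h0 h1]]]]]|nb] :=
      pselect (exists b, [/\ B b, e b = k & exists h, bumpon b h]).
    exists (h, K); split => //= b' Bb'' /einj E _ y by'.
    by apply: h1; rewrite -E ?inE.
  exists (fun=> 0, set0); split => //=.
  - by apply/smooth_fun_onT; exact: smooth_fun_on_cst.
  - exact: compact0.
  - by move=> b b1 b2 b3; case: nb; exists b.
have [psiK HpsiK] := choice ex_psi.
pose psi k := (psiK k).1; pose K k := (psiK k).2.
have psi1 (x : M) : exists k, \forall y \near x, psi k y = 1.
  have [h [K' [sh cK' _ h0 h1]]] := bump openT (I : setT x).
  have [b [Bb' bx] bh] := Bb x _ h1.
  exists (e b); have [_ _ _ /(_ b Bb' erefl) H] := HpsiK (e b).
  have /H Hb : exists h, bumpon b h by exists h, K'; split => // y /bh.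
  have nb : nbhs x b by apply: open_nbhs_nbhs; split => //; exact: Bo.
  exact: filterS Hb nb.
(* The sum of the [T i] is locally finite since [T i] vanishes where some [psi j]
   with [j <= i] is [1]; below level [k] only points where one of
   [psi 0], ..., [psi (k - 1)] is nonzero remain. *)
pose T i x := \prod_(j < i.+1) ((1 - psi j x) * (1 - psi j x)).
pose S k x := \sum_(i < k) T i x.
have sS k : smooth_fun (S k : M -> R^o).
  apply/smooth_fun_onT; have oT := @openT M; apply: smooth_fun_on_sum => // i.
  apply: smooth_fun_on_prod => // j.
  apply: smooth_fun_onM => //; apply: smooth_fun_onB => //;
    by [exact: smooth_fun_on_cst|apply/smooth_fun_onT; have [] := HpsiK j].
have S_stable a b x : psi a x = 1 -> psi b x = 1 -> S a x = S b x.
  wlog ab : a b / (a <= b)%N => [hw pa pb|pa pb].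
    have [ab|/ltnW ba] := leqP a b; first exact: hw.
    by rewrite -(hw b a).
  rewrite /S -!(big_mkord xpredT (T ^~ x)) [RHS](big_cat_nat _ (n := a))//=.
  rewrite [X in _ = _ + X]big_nat [X in _ = _ + X]big1 ?addr0// => i /andP[ai _].
  by rewrite /T (bigD1 (Ordinal (ai : (a < i.+1)%N)))//= pa subrr !mul0r.
have [N HN] := choice psi1.
(* [S k x] is the same for all [k] with [psi k x = 1], so near each point [f] coincides with one
   finite sum. *)
pose f x := S (N x) x.
have sf : smooth_fun (f : M -> R^o).
  apply: smooth_fun_near => x; exists (S (N x)) => //.
  apply: filterS (HN x) => y pNx; apply: S_stable => //.
  exact: (nbhs_singleton (HN y)).
exists f => // c.
have [k ck] : exists k, c < k%:R.
  by exists (Num.bound `|c|); exact: le_lt_trans (ler_norm c) (archi_boundP (normr_ge0 c)).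
have cf : closed [set x | f x <= c].
  rewrite (_ : [set x | _] = f @^-1` [set t | t <= c])//.
  by apply: closed_comp; [move=> x _; exact: smooth_fun_continuous|exact: closed_le].
have cKk : compact (\big[setU/set0]_(i < k) K i).
  by elim/big_ind : _ => [|A A' |i _]; [exact: compact0|exact: compactU|have [] := HpsiK i].
apply: subclosed_compact cf cKk _ => x /= fx.
apply: contrapT => nKx.
(* The factors are squares, hence nonnegative whatever the sign of [1 - psi j x]. *)
have T_ge0 i : 0 <= T i x by apply: prodr_ge0 => j _; rewrite -expr2 sqr_ge0.
have psi0 (i : 'I_k) : psi i x = 0.
  have [_ _ + _] := HpsiK i; apply => Kix; apply: nKx.
  by rewrite -(bigcup_mkord k K); exists (val i) => //=.
(* As [psi (N x) x = 1], the index [N x] is not among the first [k], so the sum for [f x] contains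
   the first [k] terms, all equal to [1]. *)
have kN : (k <= N x)%N.
  rewrite leqNgt; apply/negP => Nk; have := psi0 (Ordinal Nk).
  by rewrite /= (nbhs_singleton (HN x)) => /eqP; rewrite oner_eq0.
have : k%:R <= f x.
  rewrite /f /S -(big_mkord xpredT (T ^~ x)) (big_cat_nat _ (n := k))//=.
  rewrite big_mkord (eq_bigr (fun=> 1)) => [|i _]; last first.
    rewrite /T big1// => j _.
    by rewrite (psi0 (Ordinal (leq_trans (ltn_ord j) (ltn_ord i)))) subr0 mulr1.
  by rewrite sumr_const card_ord lerDl sumr_ge0.
by move=> /(lt_le_trans ck) /lt_le_trans /(_ fx); rewrite ltxx.
Qed.

End bump.

(** * Characters *)

Section characters.
Context {R : realType} {n : nat} {M : manifold R n}.
Implicit Types f g : Cinfty M.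

Lemma Cinfty_smooth f : smooth_fun f.
Proof. by case: f => f /=; rewrite inE. Qed.

Lemma smooth_Cinfty (f : M -> R^o) : smooth_fun f -> exists g : Cinfty M, g = f :> (M -> R^o).
Proof. by move=> sf; have H : f \in @smooth_pred R n M; [by rewrite inE|by exists (SmoothFun H)]. Qed.

(* The zero sets of the elements of the kernel of a character form a filter
   base; one of them is compact, and a cluster point is the point sought. *)
Lemma character_is_evaluation (chi : Cinfty M -> R) :
  chi 1 = 1 -> {morph chi : f g / f + g} -> {morph chi : f g / f * g} ->
  (forall k f, chi (k *: f) = k * chi f) ->
  exists p, forall f, chi f = f p.
Proof.
move=> chi1 chiD chiM chiZ.
pose Z f := [set x | f x = 0].
(* The projection of [f] to the kernel of [chi]; its zero set is the level set of [f] at [chi f]. *)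
pose ker f : Cinfty M := f - chi f *: (1 : Cinfty M).
have chiN f : chi (- f) = - chi f by rewrite -scaleN1r chiZ mulN1r.
have chi_ker f : chi (ker f) = 0 by rewrite chiD chiN chiZ chi1 mulr1 subrr.
have kerE f x : ker f x = f x - chi f.
  by rewrite -[LHS]/(f x - chi f * 1) mulr1.
have Z_neq0 f : chi f = 0 -> Z f !=set0.
  move=> f0; apply: contrapT => nZ.
  have fn0 x : f x != 0 by apply/eqP => fx; apply: nZ; exists x.
  have [g gE] := smooth_Cinfty (smooth_funV (Cinfty_smooth f) fn0).
  have fg : f * g = 1.
    by apply: val_inj; apply/funext => x; rewrite -[LHS]/(f x * g x) gE mulfV.
  by move: chi1; rewrite -fg chiM f0 mul0r => /esym/eqP; rewrite oner_eq0.
pose F := filter_from [set f | chi f = 0] Z.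
have FF : ProperFilter F.
  apply: filter_from_proper => //; apply: filter_from_filter.
    by exists (ker 1); exact: chi_ker.
  move=> f g /= f0 g0; exists (f * f + g * g).
    by rewrite /= chiD !chiM f0 g0 !mul0r addr0.
  move=> x fgx; have /eqP : f x * f x + g x * g x = 0 := fgx.
  rewrite -!expr2 paddr_eq0 ?sqr_ge0// !sqrf_eq0.
  by move=> /andP[/eqP ? /eqP ?].
have [e se ce] := @proper_smooth_fun R n M.
have [f fE] := smooth_Cinfty se.
(* The level set of the exhaustion function at [chi f] lies in a compact sublevel set, so the filter
   has a cluster point. *)
have FK : F [set x | e x <= chi f].
  exists (ker f); first exact: chi_ker.
  by move=> x kx; have fx := subr0_eq (etrans (esym (kerE f x)) kx); rewrite /= -fx fE.
have [p [_ clp]] := ce (chi f) F FF FK.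
(* The zero set of [ker g] is closed and belongs to the filter, so it contains [p]. *)
exists p => g; apply/esym/subr0_eq; rewrite -kerE.
have cZ : closed (Z (ker g)).
  rewrite (_ : Z _ = ker g @^-1` [set 0]); last by apply/seteqP; split.
  apply: closed_comp; last exact: closed_eq.
  by move=> x _; apply: smooth_fun_continuous; exact: Cinfty_smooth.
apply: cZ => B nB; apply: clp nB.
by exists (ker g) => //; exact: chi_ker.
Qed.

End characters.

(** * Maps that pull smooth functions back *)

Section smooth_separation.
Context {R : realType} {n : nat} {M : manifold R n}.

Lemma open_smooth_neq0 (f : M -> R^o) : smooth_fun f -> open [set x | f x != 0].
Proof.
move=> sf; apply: (@open_comp _ _ f [set y | y != 0]); last exact: open_neq.
by move=> x _; exact: smooth_fun_continuous.
Qed.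

(** With [open_smooth_neq0] this says that the sets [f != 0] form a base of the topology, so
    topological claims about [F] become claims about functions. *)
Lemma smooth_separation (V : set M) x : open V -> V x ->
  exists f : M -> R^o, [/\ smooth_fun f, f x != 0 & forall y, f y != 0 -> V y].
Proof.
move=> oV Vx; have [f [K [sf _ KV f0 f1]]] := bump oV Vx.
exists f; split => //; first by rewrite (nbhs_singleton f1) oner_neq0.
move=> y fy; apply: KV; apply: contrapT => /f0 fy0.
by rewrite fy0 eqxx in fy.
Qed.

Lemma smooth_inj (x y : M) : (forall f : M -> R^o, smooth_fun f -> f x = f y) -> x = y.
Proof.
move=> fxy; apply/eqP; apply: contrapT => /negP xy.
have [A [oA /set_mem Ax /set_mem Ay]] := hausdorff_accessible (@hausdorff_manifold _ _ M) xy.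
have [f [sf fx fA]] := smooth_separation oA Ax.
by apply: Ay; apply: fA; rewrite -(fxy f sf).
Qed.

End smooth_separation.

Section pullback.
Context {R : realType} {m n : nat} {M : manifold R m} {N : manifold R n} (F : N -> M).
Hypothesis smooth_pull : forall f : M -> R^o, smooth_fun f -> smooth_fun (f \o F : N -> R^o).

Lemma pullback_continuous : continuous F.
Proof.
move=> q B; rewrite nbhsE => -[V [oV Vq] VB].
have [f [sf fq fV]] := smooth_separation oV Vq.
have oW := open_smooth_neq0 (smooth_pull sf).
have : nbhs q [set x | (f \o F) x != 0] by apply: open_nbhs_nbhs; split.
by apply: filterS => x /= /fV /VB.
Qed.

Lemma open_pullback V : open V -> open (F @^-1` V).
Proof. by move=> oV; apply: open_comp => // x _; exact: pullback_continuous. Qed.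

(** A coordinate of [M] is only locally defined; near [F q] it agrees with a global smooth function,
    whose pullback is smooth. *)
Lemma pullback_coord d j : charts d ->
  smooth_fun_on (F @^-1` cdom d) (fun q => cmap d (F q) 0 j).
Proof.
move=> dM; apply: smooth_fun_on_local => q Fq.
have [f sf] := smooth_fun_extend (open_cdom d) Fq (smooth_fun_on_coord j dM).
move=> fE; have : nbhs (F q) [set y | f y = cmap d y 0 j] by exact: fE.
rewrite nbhsE => -[V [oV Vq] fV].
exists (F @^-1` V) => //; apply: (@smooth_fun_on_eq _ _ _ _ (f \o F)).
- exact: open_pullback.
- by move=> x /fV.
- by apply: smooth_fun_on_sub (iffRL (smooth_fun_onT _) (smooth_pull sf)).
Qed.

Lemma pullback_smooth : smooth_map F.
Proof.
split; first exact: pullback_continuous.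
by move=> c d cN dM j; exact: (pullback_coord j dM cN).
Qed.

Hypothesis pull_surj : forall g : N -> R^o, smooth_fun g ->
  exists2 f : M -> R^o, smooth_fun f & g = f \o F.

Lemma pullback_inj : injective F.
Proof.
move=> x y Fxy; apply: smooth_inj => g /pull_surj[f _ ->].
by rewrite /= Fxy.
Qed.

(** Near [q] the [j]-th chart coordinate of [N] is [f \o F] for a smooth [f]. The chain rule then
    recovers the [j]-th coordinate of [u] from ['d G a u]. *)
Lemma pullback_immersion : immersion F.
Proof.
split; first exact: pullback_smooth.
move=> q c d cN dM cq dFq v w vw; apply/rowP => j.
set G := cmap d \o F \o cinv c in vw *; set a := cmap c q in vw *.
have oW : open (F @^-1` cdom d) by apply: open_pullback; exact: open_cdom.
have Ga : G a = cmap d (F q) by rewrite /G /a /= cmapK.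
have dG : differentiable G a.
  apply: (@smooth_map_on_differentiable _ _ _ _ G _ (open_chart_img (c := c) oW)).
    by move=> i; exact: (pullback_coord i dM cN).
  by exists q.
have [g sg gE] := smooth_fun_extend (open_cdom c) cq (smooth_fun_on_coord j cN).
have [f sf gf] := pull_surj sg.
pose H := f \o cinv d.
have dH : differentiable (H : _ -> R^o) (G a).
  apply: (@smooth_on_differentiable R m (cimg d) H (G a) (@open_cimg _ _ _ d) (sf d dM)).
  by rewrite Ga; exists (F q).
have HG : \forall u \near a, (H \o G) u = u 0 j.
  have : nbhs q [set y | g y = cmap c y 0 j] by exact: gE.
  rewrite nbhsE => -[V [oV Vq] gV].
  have := near_cinv (openI oV oW) cq (conj Vq dFq).
  apply: filterS => _ [y [cy [Vy Wy]] <-].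
  by rewrite /H /G /= cmapK// cmapK// -gV// gf.
have key (u : 'rV[R]_n) : u 0 j = 'd (H : _ -> R^o) (G a) ('d G a u).
  rewrite -[LHS](@derive_val _ _ _ _ _ _ _ (is_derive_coord j a u)).
  rewrite -(near_eq_derive u HG) deriveE; last exact: differentiable_comp.
  by rewrite diff_comp.
by rewrite !key vw.
Qed.

Lemma pullback_embedding : topological_embedding F.
Proof.
split; [exact: pullback_continuous|exact: pullback_inj|move=> A oA].
(* The open set sought is the union of all sets [f != 0] whose preimage under [F] lies in [A];
   surjectivity supplies enough of them. *)
pose D := [set f : M -> R^o | smooth_fun f /\ forall q, f (F q) != 0 -> A q].
exists (\bigcup_(f in D) [set x | f x != 0]).
  by apply: bigcup_open => f [sf _]; exact: open_smooth_neq0.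
apply/seteqP; split.
- move=> _ [q Aq <-]; split; first by exists q.
  have [g [sg gq gA]] := smooth_separation oA Aq.
  have [f sf gf] := pull_surj sg.
  by rewrite gf in gq gA; exists f.
- by move=> _ [[q _ <-] [f [_ fA] /= /fA Aq]]; exists q.
Qed.

(** An exhaustion function of [N] has the form [f \o F]. As [f] is bounded on [K], the preimage of
    [K] is a closed part of a compact sublevel set. *)
Lemma pullback_proper : proper_map F.
Proof.
split; first exact: pullback_continuous.
move=> K cK; have [g sg cg] := @proper_smooth_fun R n N.
have [f sf gf] := pull_surj sg.
have clK : closed (F @^-1` K).
  apply: closed_comp => [x _|]; first exact: pullback_continuous.
  by apply: compact_closed cK; exact: hausdorff_manifold.
have [B HB] : exists B : R, forall x, K x -> f x <= B.
  have cfK : compact (f @` K).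
    apply: continuous_compact cK; apply: continuous_subspaceT => x.
    exact: smooth_fun_continuous.
  have [B [_ HB]] := compact_bounded cfK.
  exists (B + 1) => x Kx; apply: le_trans (ler_norm _) _.
  by apply: (HB (B + 1)); [rewrite ltrDl|exists x].
apply: (subclosed_compact clK (cg B)) => q /= /HB.
by rewrite gf.
Qed.

(** Intersect the range with a compact neighbourhood [K] of [p]. The result is the image of the
    compact preimage of [K], hence closed, and [p] is still in its closure. *)
Lemma pullback_closed : closed (range F).
Proof.
move=> p clp; have [f [K [sf cK _ f0 f1]]] := bump (@openT M) (I : setT p).
have cFK : compact (F @` (F @^-1` K)).
  have [_ /(_ K cK) cFK] := pullback_proper.
  by apply: continuous_compact cFK; apply: continuous_subspaceT; exact: pullback_continuous.
have clFK : closed (F @` (F @^-1` K)).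
  by apply: compact_closed cFK; exact: hausdorff_manifold.
suff [q _ <-] : (F @` (F @^-1` K)) p by exists q.
apply: clFK => B nB.
have [_ [[q _ <-] [Bq fq]]] := clp _ (filterI nB f1).
exists (F q); split => //; exists q => //=.
by apply: contrapT => /f0 => /eqP; rewrite fq oner_eq0.
Qed.

End pullback.

(** * Transport of smooth structures *)

Section transport.
Context {R : realType} {n : nat} {N : manifold R n} (T : topologicalType).
Variables (h : N -> T) (k : T -> N).
Hypotheses (hc : continuous h) (kc : continuous k) (hk : cancel h k) (kh : cancel k h).

(** Transported charts have the same images in ['rV[R]_n], so openness and compatibility reduce to
    those for [N]. *)
Lemma image_comp_preimage (c : chart R n N) (A : set N) :
  (cmap c \o k) @` (k @^-1` A) = cmap c @` A.
Proof.
apply/seteqP; split=> [_ [s As <-]|_ [x Ax <-]]; first by exists (k s).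
by exists (h x); rewrite /= hk.
Qed.

Section transport_chart.
Variable c : chart R n N.

Lemma transport_open_cdom : open (k @^-1` cdom c).
Proof. by apply: open_comp => [x _|]; [exact: kc|exact: open_cdom]. Qed.

Lemma transport_open_cimg : open ((cmap c \o k) @` (k @^-1` cdom c)).
Proof. by rewrite image_comp_preimage; exact: open_cimg. Qed.

Lemma transport_cmapK s : (k @^-1` cdom c) s -> (h \o cinv c) ((cmap c \o k) s) = s.
Proof. by move=> cs; rewrite /= cmapK. Qed.

Lemma transport_cmap_continuous s :
  (k @^-1` cdom c) s -> {for s, continuous (cmap c \o k)}.
Proof. by move=> cs; apply: continuous_comp; [exact: kc|exact: cmap_continuous]. Qed.

Lemma transport_cinv_continuous v :
  ((cmap c \o k) @` (k @^-1` cdom c)) v -> {for v, continuous (h \o cinv c)}.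
Proof.
rewrite image_comp_preimage => cv.
by apply: continuous_comp; [exact: cinv_continuous|exact: hc].
Qed.

Definition transport_chart : chart R n T :=
  Chart transport_open_cdom transport_open_cimg transport_cmapK
    transport_cmap_continuous transport_cinv_continuous.

End transport_chart.

Definition transport_atlas : set (chart R n T) := transport_chart @` @charts R n N.

Lemma transport_cover s : exists2 c, transport_atlas c & cdom c s.
Proof.
have [c cN cs] := chart_cover (k s).
by exists (transport_chart c) => //; exists c.
Qed.

Lemma transport_compatible c d : transport_atlas c -> transport_atlas d ->
  smooth_map_on (cmap c @` (cdom c `&` cdom d)) (cmap d \o cinv c).
Proof.
move=> [c' c'N <-] [d' d'N <-] /=.
rewrite -preimage_setI image_comp_preimage.
rewrite (_ : _ \o _ = cmap d' \o cinv c'); first exact: (atlas_compatible c'N d'N).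
by apply/funext => v /=; rewrite hk.
Qed.

Definition transport_structure : smooth_structure R n T :=
  SmoothStructure transport_cover transport_compatible.

Lemma transport_hausdorff : hausdorff_space T.
Proof.
move=> s t clst; apply: (can_inj kh); apply: hausdorff_manifold => A B nA nB.
have [u [Au Bu]] := clst _ _ (kc nA) (kc nB).
by exists (k u).
Qed.

Lemma transport_second_countable : @second_countable T.
Proof.
have [B cB [Bo Bb]] := second_countable_manifold N.
exists ((fun b : set N => k @^-1` b) @` B); first exact: (card_le_trans (card_image_le _ _)).
split=> [_ [b Bb' <-]|s U nU].
  by apply: open_comp => [x _|]; [exact: kc|exact: Bo].
have nhU : nbhs (k s) (h @^-1` U) by apply: hc; rewrite kh.
have [b [Bb' bs] bU] := Bb (k s) _ nhU.
exists (k @^-1` b); first by split => //; exists b.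
by move=> t /bU /=; rewrite kh.
Qed.

End transport.

(** * The image of an embedding as a submanifold *)

Section embedded.
Context {R : realType} {m n : nat} {M : manifold R m} {N : manifold R n} (F : N -> M).
Hypothesis embF : smooth_embedding F.

Let to_range (q : N) : set_type (range F) := SigSub (mem_set (imageT F q)).

Let ex_preimage (s : set_type (range F)) : exists q, F q = set_val s.
Proof. by have [q _ qE] := set_mem (valP s); exists q. Qed.

(** [F] is a homeomorphism onto its range. With the structure of [N] transported along it, the
    inclusion read in charts is [F] read in charts. *)
Lemma embedded_submanifold_range : embedded_submanifold (range F).
Proof.
have [[[Fc sF] immF] [_ injF openF]] := embF.
have [k kE] := choice ex_preimage.
have hk : cancel to_range k by move=> q; apply: injF; rewrite kE.
have kh : cancel k to_range by move=> s; apply: val_inj; rewrite /= kE.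
have hc : continuous to_range.
  apply/continuousP => _ [B oB <-].
  rewrite (_ : _ @^-1` _ = F @^-1` B)//; apply: open_comp => // x _; exact: Fc.
(* Continuity of the inverse is openness of [F] onto its range. *)
have kc : continuous k.
  apply/continuousP => A /openF[B oB FAB]; exists B => //.
  apply/seteqP; split=> s /=.
    move=> Bs; have : (range F `&` B) (set_val s).
      by split => //; exists (k s).
    by rewrite -FAB => -[q Aq]; rewrite -(kE s) => /injF <-.
  move=> Aks; have : (F @` A) (F (k s)) by exists (k s).
  by rewrite FAB kE => -[].
exists n, (transport_structure hc kc hk kh), (transport_hausdorff kc kh),
  (transport_second_countable hc kc kh).
have FkE (c : chart R n N) d :
    (k @^-1` cdom c) `&` (set_val @^-1` cdom d) = k @^-1` (cdom c `&` F @^-1` cdom d).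
  by apply/seteqP; split=> s /= [cs ds]; split => //; move: ds; rewrite kE.
have vc : continuous (set_val : set_type (range F) -> M) by exact: initial_continuous.
split; first split.
- split => // _ d [c cN <-] dM /=.
  by rewrite FkE (image_comp_preimage hk); exact: sF.
- move=> s _ d [c cN <-] dM /= cs ds.
  by apply: (immF (k s)) => //; rewrite kE.
split; [exact: vc|by move=> s t st; exact: val_inj|].
move=> A [B oB <-]; exists B => //.
apply/seteqP; split=> [_ [s Bs <-]|_ [[q _ <-] BFq]].
  by split => //; exists s.
by exists q.
Qed.

End embedded.

Theorem theorem11 (R : realType) (m n : nat) (M : manifold R m) (N : manifold R n)
    (pi : {rmorphism Cinfty M -> Cinfty N}) (pi_scalable : scalable pi)
    (pi_surj : forall g : Cinfty N, exists f : Cinfty M, pi f = g) :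
  exists F : N -> M,
    [/\ proper_embedding F,
        forall f : Cinfty M, pi f = f \o F :> (N -> R),
        closed (range F) &
        embedded_submanifold (range F)].
Proof.
have ex_F q : exists p, forall f : Cinfty M, pi f q = f p.
  apply: (@character_is_evaluation _ _ _ (fun f => pi f q)).
  - by rewrite rmorph1.
  - by move=> f g; rewrite rmorphD.
  - by move=> f g; rewrite rmorphM.
  - by move=> k f; rewrite pi_scalable.
have [F piF] := choice ex_F.
have piE (f : Cinfty M) : pi f = f \o F :> (N -> R) by apply/funext => q; exact: piF.
(* [pull] and [surj] express through [F] alone that [pi] takes values in smooth functions and is
   surjective. *)
have pull (f : M -> R^o) : smooth_fun f -> smooth_fun (f \o F : N -> R^o).
  by move=> /smooth_Cinfty[g <-]; rewrite -piE; exact: Cinfty_smooth.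
have surj (g : N -> R^o) : smooth_fun g -> exists2 f : M -> R^o, smooth_fun f & g = f \o F.
  move=> /smooth_Cinfty[g' <-]; have [f <-] := pi_surj g'.
  by exists f; [exact: Cinfty_smooth|exact: piE].
have embF : smooth_embedding F.
  by split; [exact: pullback_immersion|exact: pullback_embedding].
exists F; split => //.
- by split => //; exact: pullback_proper.
- exact: pullback_closed.
- exact: embedded_submanifold_range.
Qed.
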